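(* Let $1\le a<b\le\infty$, let $\psi\in\Psi(a,b)$ and $\zeta,\nu\in E\Psi(a,b)$ with $\zeta(p)=\psi(p)\,\nu(p)$ for $p\in(a,b)$. Then the Boyd indices of the pair $(G(\psi),G(\zeta))$ are $$B^+(G(\psi),G(\zeta))=\frac{\vec d+\vec\theta}{a},\qquad B^-(G(\psi),G(\zeta))=\frac{\vec d+\vec\theta}{b},$$ i.e. for each $j=1,\dots,k$ the defining limits exist and $B_j^+(G(\psi),G(\zeta))=(d(j)+\theta(j))/a$, $B_j^-(G(\psi),G(\zeta))=(d(j)+\theta(j))/b$ (with $1/b=0$ if $b=\infty$).
   Context: Setting. $X=\mathbb{R}_+^{d(1)}\times\cdots\times\mathbb{R}_+^{d(k)}$, where $k\ge1$, $d(j)\ge 1$ are integers, $\mathbb{R}_+=[0,\infty)$; points are written $x=(x(d(1)),\dots,x(d(k)))$ with $x(d(j))\in\mathbb{R}_+^{d(j)}$. $X$ carries the Borel $\sigma$-algebra and the measure $\mu(V)=\int_V W(x)\,dx$, where $W(x)=\prod_{r=1}^k W_r(x(d(r)))$ and each $W_r$ is nontrivial (not identically zero), nonnegative, continuous away from the origin, and homogeneous of order $\theta(r)\in\mathbb{R}$: $W_r(\lambda y)=\lambda^{\theta(r)}W_r(y)$ for all $\lambda>0$. Put $\vec d=(d(1),\dots,d(k))$, $\vec\theta=(\theta(1),\dots,\theta(k))$. Classes of functions. For $1\le a<b\le\infty$, $E\Psi(a,b)$ is the set of continuous functions $\psi:(a,b)\to[1,\infty)$ such that the limits $\psi(a+0)$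 and $\psi(b-0)$ exist (possibly infinite) and $\psi(b-0)=\infty$. $\Psi(a,b)$ is the subset of those $\psi\in E\Psi(a,b)$ having a representation: there is a measurable $f:X\to\mathbb{R}$ with $f\in\bigcap_{p\in(a,b)}L_p(X,\mu)$ and $\psi(p)=|f|_p$ for all $p\in(a,b)$, where $|f|_p=\left(\int_X|f|^p\,d\mu\right)^{1/p}$. Bilateral Grand Lebesgue space. For $\psi\in E\Psi(a,b)$, $G(\psi)=G(\psi;a,b)$ is the space of measurable $h:X\to\mathbb{R}$ (modulo a.e. equality) with $\|h\|G(\psi)=\sup_{p\in(a,b)}|h|_p/\psi(p)<\infty$. Dilation operator and Boyd indices. For a vector $\vec s=(s(1),\dots,s(k))$ with positive entries, $\sigma_{\vec s}f(x)=f\left(\frac{x(d(1))}{s(1)},\dots,\frac{x(d(k))}{s(k)}\right)$. For rearrangement invariant spaces $V_1,V_2$ over $(X,\mu)$ such that all $\sigma_{\vec s}:V_1\to V_2$ are bounded, let $h(\vec s,V_1,V_2)$ be the operator norm of $\sigma_{\vec s}:V_1\to V_2$. The particular Boyd indices are (with the other coordinates $s(i)$, $i\ne j$, fixed) $$B_j^+(V_1,V_2)=\lim_{s(j)\to\infty}\frac{\log h(\vec s,V_1,V_2)}{\log s(j)},\qquad B_j^-(V_1,V_2)=\lim_{s(j)\to0}\frac{\log h(\vec s,V_1,V_2)}{\log s(j)},$$ and $B^\pm(V_1,V_2)=(B_1^\pm(V_1,V_2),\dots,B_k^\pm(V_1,V_2))$.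
   Formalization: The formulas for the j-th indices are stated only when d(j)+θ(j) ≥ 0; when d(j)+θ(j) < 0 the values at a and b are exchanged (B_j^+ = (d(j)+θ(j))/b, B_j^- = (d(j)+θ(j))/a), so the claim as stated fails there. *)

(* Defs.v *)
From HB Require Import structures.
From mathcomp Require Import all_boot all_order all_algebra.
From mathcomp Require Import all_classical all_reals all_analysis.
From mathcomp Require Import measurable_realfun.

Set Implicit Arguments.
Unset Strict Implicit.
Unset Printing Implicit Defensive.
Import Order.TTheory GRing.Theory Num.Theory.
Import numFieldNormedType.Exports.

Local Open Scope classical_set_scope.
Local Open Scope ring_scope.

(* The library equips n.-tuple with the product sigma-algebra, which is the
   Borel sigma-algebra of R^n. *)
Notation euclid R n := (n.-tuple (measurableTypeR R)).

Section lebesgue_cons.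
Context {R : realType} {n : nat}.
Local Open Scope ereal_scope.

Definition cons_pair (z : measurableTypeR R * euclid R n) : euclid R n.+1 :=
  [tuple of z.1 :: z.2].

Lemma measurable_cons_pair : measurable_fun setT cons_pair.
Proof. by apply: measurable_cons. Qed.

Definition uncons_pair (x : euclid R n.+1) : measurableTypeR R * euclid R n :=
  (thead x, [tuple of behead x]).

Lemma cons_pairK : cancel cons_pair uncons_pair.
Proof. by move=> [a t]; congr (_, _); apply: val_inj. Qed.

Lemma uncons_pairK : cancel uncons_pair cons_pair.
Proof. by move=> x; rewrite [RHS]tuple_eta; apply: val_inj. Qed.

Lemma measurable_uncons_pair : measurable_fun setT uncons_pair.
Proof.
apply/measurable_fun_pairP; split; first exact: measurable_tnth.
exact: measurable_behead.
Qed.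

Variable m : {sigma_finite_measure set (euclid R n) -> \bar R}.

Definition lebesgue_cons (A : set (euclid R n.+1)) : \bar R :=
  (lebesgue_measure \x m) (cons_pair @^-1` A).

Let lebesgue_cons0 : lebesgue_cons set0 = 0.
Proof. by rewrite /lebesgue_cons preimage_set0 measure0. Qed.

Let lebesgue_cons_ge0 A : 0 <= lebesgue_cons A.
Proof. by apply: integral_ge0 => x _; exact: measure_ge0. Qed.

Let measurable_preimage_cons (A : set (euclid R n.+1)) :
  measurable A -> measurable (cons_pair @^-1` A).
Proof. by move=> mA; rewrite -[X in measurable X]setTI; exact: measurable_cons_pair. Qed.

Let lebesgue_cons_sigma_additive : semi_sigma_additive lebesgue_cons.
Proof.
move=> F mF tF mUF; rewrite /lebesgue_cons preimage_bigcup.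
apply: measure_semi_sigma_additive.
- by move=> i; exact: measurable_preimage_cons.
- apply/trivIsetP => /= i j _ _ ij; rewrite -preimage_setI.
  by move/trivIsetP : tF => /(_ _ _ _ _ ij) ->//; rewrite preimage_set0.
- by rewrite -preimage_bigcup; exact: measurable_preimage_cons.
Qed.

HB.instance Definition _ := isMeasure.Build _ _ _ lebesgue_cons
  lebesgue_cons0 lebesgue_cons_ge0 lebesgue_cons_sigma_additive.

Let lebesgue_cons_sigma_finite : sigma_finite setT lebesgue_cons.
Proof.
have /sigma_finiteP[F' [TF' ndF' Foo']] := sigma_finiteT m.
have /sigma_finiteP[G [TG ndG Goo]] := sigma_finiteT (@lebesgue_measure R).
exists (fun i => uncons_pair @^-1` (G i `*` F' i)).
  rewrite -preimage_bigcup -[LHS](preimage_setT uncons_pair); congr (_ @^-1` _).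
  apply/seteqP; split => // -[x y] _.
  have : [set: measurableTypeR R] x by [].
  have : [set: euclid R n] y by [].
  rewrite TF' TG => -[i _ F'iy] [j _ Gjx].
  exists (maxn i j) => //; split => /=.
    by move: x Gjx; exact/subsetPset/ndG/leq_maxr.
  by move: y F'iy; exact/subsetPset/ndF'/leq_maxl.
move=> i; have [mG Gi] := Goo i; have [mF' F'i] := Foo' i; split.
  rewrite -[X in measurable X]setTI; apply: measurable_uncons_pair => //.
  exact: measurableX.
rewrite /lebesgue_cons -comp_preimage.
rewrite (_ : uncons_pair \o cons_pair = id); last exact/funext/cons_pairK.
by rewrite preimage_id product_measure1E// lte_mul_pinfty// ge0_fin_numE.
Qed.

HB.instance Definition _ := Measure_isSigmaFinite.Build _ _ _ lebesgue_cons
  lebesgue_cons_sigma_finite.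

End lebesgue_cons.

(* Lebesgue measure on R^n; R^0 is a point of mass 1. *)
Fixpoint lebesgue_euclid (R : realType) (n : nat) :
    {sigma_finite_measure set (euclid R n) -> \bar R} :=
  match n with
  | 0 => \d_([tuple] : euclid R 0)
  | n'.+1 => lebesgue_cons (lebesgue_euclid R n')
  end.

Lemma lebesgue_euclid_box (R : realType) n (A : 'I_n -> set (measurableTypeR R)) :
  (forall i, measurable (A i)) ->
  lebesgue_euclid R n [set x | forall i, A i (tnth x i)] =
  (\prod_(i < n) lebesgue_measure (A i))%E.
Proof.
elim: n A => [|n IHn] A mA.
  rewrite big_ord0 /= diracE mem_set//; by case.
rewrite big_ord_recl /= /lebesgue_cons.
rewrite (_ : _ @^-1` _ =
  A ord0 `*` [set x : euclid R n | forall i, A (lift ord0 i) (tnth x i)]).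
  rewrite product_measure1E//; last first.
    rewrite (_ : [set _ | _] = \bigcap_i ((fun x => tnth x i) @^-1` A (lift ord0 i))).
      apply: fin_bigcap_measurable => // i _.
      by rewrite -[X in measurable X]setTI; exact: measurable_tnth.
    by apply/seteqP; split => x h i; [move=> _; exact: h|exact: h].
  by congr (_ * _)%E; exact: IHn.
apply/seteqP; split => -[a t] /= h.
  split => [|i]; first exact: (h ord0).
  by have := h (lift ord0 i); rewrite tnthS.
by move=> i; have [j ->|->] := unliftP ord0 i; [rewrite tnthS; exact: h.2|exact: h.1].
Qed.

Section weight.
Context {R : realType}.
Implicit Type n : nat.

Definition orthant n : set 'rV[R]_n := [set y | forall i, 0 <= y 0 i].

(* Functions on R_+^n are represented by total functions on R^n of which only
   the values on the orthant are constrained. *)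
Record homogeneous_weight n (theta : R) := HomogeneousWeight {
  weight_fun :> 'rV[R]_n -> R ;
  weight_neq0 : exists2 y, orthant y & weight_fun y != 0 ;
  weight_ge0 : forall y, orthant y -> 0 <= weight_fun y ;
  weight_continuous : {within @orthant n `\ 0, continuous weight_fun} ;
  weight_homogeneous : forall (lambda : R) y, 0 < lambda -> orthant y ->
    weight_fun (lambda *: y) = lambda `^ theta * weight_fun y }.

Section measurability.
Context {d : measure_display} {T : measurableType d} {n : nat}.
Variable f : T -> 'rV[R]_n.
Hypothesis mf : forall i, measurable_fun setT (fun x => f x 0 i).

Lemma measurable_preimage_open (U : set 'rV[R]_n) :
  open U -> measurable (f @^-1` U).
Proof.
move=> oU.
pose box (cq : 'rV[rat]_n * nat) : set 'rV[R]_n :=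
  [set y | forall i, ball (ratr (cq.1 0 i) : R) (cq.2.+1%:R^-1) (y 0 i)].
pose F cq := if `[< box cq `<=` U >] then f @^-1` (box cq) else set0.
have -> : f @^-1` U = \bigcup_cq F cq.
  apply/seteqP; split => [x /= Ux|x [cq _]]; last first.
    by rewrite /F; case: asboolP => // + ?; apply.
  have /nbhs_ballP[e /= e0 eU] : nbhs (f x) U by exact: open_nbhs_nbhs.
  have [q qe] : exists q : nat, (q.+1%:R^-1 : R) < e / 2.
    by have := near_infty_natSinv_lt (PosNum (divr_gt0 e0 (ltr0Sn R 1))) => -[q _ /(_ q (leqnn q))]; exists q.
  have q0 : 0 < (q.+1%:R^-1 : R) by rewrite invr_gt0.
  have /choice[c cP] : forall i, exists c : rat,
      ball (f x 0 i) (q.+1%:R^-1 : R) (ratr c).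
    move=> i; have := @rat_in_itvoo R (f x 0 i) (f x 0 i + q.+1%:R^-1).
    rewrite ltrDl => /(_ q0)[c]; rewrite in_itv/= => /andP[c1 c2]; exists c.
    by rewrite /ball/= distrC ger0_norm ?subr_ge0 1?ltW// ltrBlDl.
  exists (\row_i c i, q) => //; rewrite /F; case: asboolP => [_|]; last first.
    apply: contra_notP => _ y /= yc; apply: eU; split => // j i.
    rewrite (ord1 j) [e]splitr; apply: (@ball_triangle _ _ (ratr (c i) : R)).
      by apply: le_ball (cP i); exact: ltW.
    by have := yc i; rewrite /= mxE; apply: le_ball; exact: ltW.
  by move=> i /=; rewrite mxE; exact/ball_sym/cP.
apply: countable_bigcupT_measurable; first exact: countableP.
move=> cq; rewrite /F; case: asboolP => // _.
rewrite (_ : _ @^-1` _ = \bigcap_i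
    ((fun x => f x 0 i) @^-1` ball (ratr (cq.1 0 i) : R) (cq.2.+1%:R^-1))).
  apply: fin_bigcap_measurable => // i _.
  rewrite -[X in measurable X]setTI; apply: mf => //.
  by rewrite ball_itv; exact: measurable_itv.
by apply/seteqP; split => x h i; [move=> _; exact: h|exact: h].
Qed.

Lemma measurable_preimage_orthant : measurable (f @^-1` @orthant n).
Proof.
rewrite (_ : _ @^-1` _ = \bigcap_i ((fun x => f x 0 i) @^-1` `[0, +oo[)).
  apply: fin_bigcap_measurable => // i _.
  by rewrite -[X in measurable X]setTI; apply: mf => //; exact: measurable_itv.
apply/seteqP; split => x h i; first by move=> _; rewrite /= in_itv/= andbT; exact: h.
by have := h i I; rewrite /= in_itv/= andbT.
Qed.

Lemma measurable_preimage_row0 : measurable (f @^-1` [set 0]).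
Proof.
rewrite (_ : _ @^-1` _ = \bigcap_i ((fun x => f x 0 i) @^-1` [set 0])).
  apply: fin_bigcap_measurable => // i _.
  by rewrite -[X in measurable X]setTI; apply: mf.
apply/seteqP; split => x /= h; first by move=> i _ /=; rewrite h mxE.
by apply/rowP => i; rewrite mxE; exact: h.
Qed.

Lemma measurable_weight theta (w : homogeneous_weight n theta) :
  measurable_fun (f @^-1` @orthant n) (w \o f).
Proof.
have mO := measurable_preimage_orthant; have m0 := measurable_preimage_row0.
rewrite (_ : _ @^-1` _ = f @^-1` (@orthant n `\ 0) `|` f @^-1` [set 0]); last first.
  apply/seteqP; split => [x /= fx|x /= [[]//|->]]; last by move=> i; rewrite mxE.
  by have [fx0|fx0] := pselect (f x = 0); [right|left].
have mD : measurable (f @^-1` (@orthant n `\ 0)).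
  exact: (measurableD mO m0).
apply/measurable_funU => //; split; last first.
  by apply: (eq_measurable_fun (cst (w 0))) => // x; rewrite inE /= => ->.
apply: (measurability _ (RGenOpens.measurableE R)).
move=> _ [_ [a [b ->] <-]].
have /continuousP cw := @weight_continuous _ _ w.
have : open (`]a, b[%classic : set R) by exact: interval_open.
move=> /cw/open_subspaceP[V oV VE].
have -> : f @^-1` (@orthant n `\ 0) `&` (w \o f) @^-1` `]a, b[ =
    f @^-1` (V `&` (@orthant n `\ 0)) by rewrite VE setIC.
by apply: (measurableI _ _ _ mD); exact: measurable_preimage_open.
Qed.

End measurability.
End weight.

Section product_space.
Context {R : realType} {k : nat}.
Variable d : 'I_k -> nat.

(* R^d(1) x ... x R^d(k), flattened: tagnat.Rank sends the coordinate i of the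
   block j to its global index, and tagnat.sig1 recovers j from that index. *)
Local Notation ambient := (euclid R (\sum_j d j)).

Definition block (j : 'I_k) (x : ambient) : 'rV[R]_(d j) :=
  \row_i tnth x (tagnat.Rank j i).

(* The set X. A measurable function on X is represented by a measurable function
   on the ambient space, all measures considered below being carried by X. *)
Definition positive_cone : set ambient :=
  [set x | forall j, orthant (block j x)].

Definition block_div (s : 'I_k -> R) (x : ambient) : ambient :=
  [tuple tnth x i / s (tagnat.sig1 i) | i < \sum_j d j].

Lemma block_divE s x j : block j (block_div s x) = (s j)^-1 *: block j x.
Proof.
by apply/rowP => i; rewrite !mxE tnth_mktuple tagnat.Rank1K mulrC.
Qed.

Definition dilation (s : 'I_k -> R) (f : ambient -> R) : ambient -> R :=
  fun x => f (block_div s x).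

Lemma measurable_block j i : measurable_fun setT (fun x => block j x 0 i).
Proof.
rewrite (_ : (fun _ => _) = (fun x : ambient => tnth x (tagnat.Rank j i))).
  exact: measurable_tnth.
by apply/funext => x; rewrite mxE.
Qed.

Lemma measurable_positive_cone : measurable positive_cone.
Proof.
rewrite (_ : positive_cone = \bigcap_j (block j @^-1` @orthant R (d j))).
  apply: fin_bigcap_measurable => // j _.
  exact: (measurable_preimage_orthant (@measurable_block j)).
by apply/seteqP; split => x h j; [move=> _; exact: h|exact: h].
Qed.

(* Spaces V1, V2 of measurable functions are given by their norms N1, N2. *)
Section boyd.
Variables N1 N2 : (ambient -> R) -> \bar R.
Local Open Scope ereal_scope.

Definition dilation_norm (s : 'I_k -> R) : \bar R :=
  ereal_sup [set N2 (dilation s f) |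
             f in [set f | measurable_fun setT f /\ N1 f <= 1]].

(* s supplies the fixed coordinates s(i), i != j; the value s j is not used. *)
Definition boyd_quotient (j : 'I_k) (s : 'I_k -> R) (t : R) : \bar R :=
  lne (dilation_norm [eta s with j |-> t]) / (ln t)%:E.

Definition boyd_upper j s : \bar R := lim (boyd_quotient j s t @[t --> +oo%R]).

Definition boyd_lower j s : \bar R := lim (boyd_quotient j s t @[t --> 0^'+]).

End boyd.

Section weighted_measure.
Context {theta : 'I_k -> R}.
Variable W : forall r, @homogeneous_weight R (d r) (theta r).

Definition density (x : ambient) : R := \prod_r W r (block r x).

Lemma density_ge0 x : positive_cone x -> 0 <= density x.
Proof. by move=> Xx; apply: prodr_ge0 => r _; exact: weight_ge0. Qed.

Lemma measurable_density : measurable_fun positive_cone density.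
Proof.
apply: measurable_prod => r _.
apply: measurable_funS (measurable_weight (@measurable_block r) (W r)).
  exact: (measurable_preimage_orthant (@measurable_block r)).
by move=> x; exact.
Qed.

Local Open Scope ereal_scope.

Definition weighted_measure (V : set ambient) : \bar R :=
  \int[lebesgue_euclid R _]_(x in V `&` positive_cone) (density x)%:E.

Let weighted_measure0 : weighted_measure set0 = 0.
Proof. by rewrite /weighted_measure set0I integral_set0. Qed.

Let weighted_measure_ge0 V : 0 <= weighted_measure V.
Proof.
by apply: integral_ge0 => x [_ Xx]; rewrite lee_fin; exact: density_ge0.
Qed.

Let weighted_measure_sigma_additive : semi_sigma_additive weighted_measure.
Proof.
move=> F mF tF mUF; rewrite /weighted_measure setI_bigcupl.
have mFX i : measurable (F i `&` positive_cone).
  by apply: measurableI => //; exact: measurable_positive_cone.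
rewrite ge0_integral_bigcup//=.
- apply: is_cvg_ereal_nneg_natsum_cond => n _ _.
  exact: weighted_measure_ge0.
- apply/measurable_EFinP; apply: measurable_funS measurable_density.
    exact: measurable_positive_cone.
  by move=> x [i _ []].
- by move=> x [i _ [_ Xx]]; rewrite lee_fin; exact: density_ge0.
- exact: trivIset_setIr.
Qed.

HB.instance Definition _ := isMeasure.Build _ _ _ weighted_measure
  weighted_measure0 weighted_measure_ge0 weighted_measure_sigma_additive.

End weighted_measure.
End product_space.

Section grand_lebesgue.
Context {d : measure_display} {T : measurableType d} {R : realType}.
Variable mu : {measure set T -> \bar R}.
Variables (a : R) (b : \bar R).

Definition exponent_range : set R := [set p | a < p /\ (p%:E < b)%E].

(* The case b = -oo never occurs, as a < b. *)
Definition left_of_b : set_system R :=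
  match b with r%:E => r^'- | _ => pinfty_nbhs R end.

(* E Psi(a, b); as exponent_range is open, continuity there is pointwise. *)
Definition EPsi (psi : R -> R) : Prop :=
  [/\ forall p, exponent_range p -> {for p, continuous psi},
      forall p, exponent_range p -> 1 <= psi p,
      cvg ((psi p)%:E @[p --> a^'+]) &
      (psi p)%:E @[p --> left_of_b] --> +oo%E].

Definition Psi (psi : R -> R) : Prop :=
  EPsi psi /\ exists2 f : T -> R, measurable_fun setT f &
    forall p, exponent_range p -> Lnorm mu p%:E (EFin \o f) = (psi p)%:E.

(* The space G(psi; a, b) consists of the measurable f with finite gls_norm. *)
Definition gls_norm (psi : R -> R) (f : T -> R) : \bar R :=
  ereal_sup [set Lnorm mu p%:E (EFin \o f) / (psi p)%:E | p in exponent_range]%E.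

End grand_lebesgue.

(* Main.v *)
Require Import Defs.
From HB Require Import structures.
From mathcomp Require Import all_boot all_order all_algebra.
From mathcomp Require Import all_classical all_reals all_analysis.
From mathcomp Require Import measurable_realfun.
From mathcomp Require Import lra.
Import Order.TTheory GRing.Theory Num.Theory.
Import numFieldNormedType.Exports.
Set Implicit Arguments.
Unset Strict Implicit.
Unset Printing Implicit Defensive.

Local Open Scope classical_set_scope.
Local Open Scope ring_scope.

(** Write D(s) for the product of the s(r) ^ (d(r) + theta(r)). Lebesgue measure
and the homogeneous weight make the dilation by s multiply the weighted measure
by D(s), hence (Lnorm_dilation)

  |sigma_s f|_p = D(s) ^ (1/p) |f|_p   for every p in (a, b) and every measurable f.

A function f of the unit ball of G(psi) satisfies |f|_p <= psi(p) for all p, and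
the function that represents psi attains equality for all p at once. Since
zeta = psi nu, the norm of the dilation is therefore exactly (dilation_normE)

  h(s) = sup over p in (a, b) of D(s) ^ (1/p) / nu(p).

This supremum is positive and finite, because 1/p stays in (0, 1] and nu >= 1. It
remains to let one coordinate t = s(j) vary. Then log D = kappa + c log t with
c = d(j) + theta(j), which is assumed nonnegative, and kappa independent of t,
and

  log h = sup over p of ((kappa + c log t) / p - log nu(p)).

After division by log t the terms kappa / p and log nu(p) disappear in the limit
for each fixed p, so the supremum selects the extreme slope among the c / p. For
t -> oo this is c / a. For t -> 0+ the division by the negative number log t turns
the supremum into an infimum, which is c / b (0 if b = oo). The bound of log h on the other
side only uses nu >= 1 and is uniform in p. Both limits are instances of one
squeeze lemma (cvg_from_affine_bounds). *)

(** * Scaling of Lebesgue measure *)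

Section lebesgue_scaling.
Context {R : realType}.
Local Open Scope ereal_scope.

(** Lebesgue measure is determined by half-open intervals, and on these the
rescaled image measure can be computed. *)
Lemma lebesgue_measure_div (v : R) (A : set (measurableTypeR R)) :
  (0 < v)%R -> measurable A ->
  lebesgue_measure
    ((fun x : measurableTypeR R => (x / v)%R : measurableTypeR R) @^-1` A) =
  v%:E * lebesgue_measure A.
Proof.
move=> v0 mA.
pose f (x : measurableTypeR R) : measurableTypeR R := (x / v)%R.
have mf : measurable_fun setT f by exact: measurable_funM.
have v'0 : (0 <= v^-1)%R by rewrite invr_ge0 ltW.
have -> : lebesgue_measure A =
    pushforward (mscale (NngNum v'0) (@lebesgue_measure R)) f A.
  apply: lebesgue_measure_unique => //= _ [[x y] _ <-].
  rewrite /pushforward /= /mscale /=.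
  have -> : f @^-1` `]x, y] = `](x * v)%R, (y * v)%R]%classic.
    apply/seteqP; split => z /=;
      by rewrite !in_itv /= /f ltr_pdivlMr// ler_pdivrMr.
  rewrite !lebesgue_measure_itv /= !lte_fin ltr_pM2r//.
  case: ifPn => _; last by rewrite mule0.
  by rewrite -!EFinD -EFinM -mulrBl mulrC mulfK// gt_eqF.
by rewrite /pushforward /= /mscale /= muleA -EFinM divff ?gt_eqF// mul1e.
Qed.

Definition coord_div n (v : 'I_n -> R) (x : euclid R n) : euclid R n :=
  [tuple (tnth x i / v i)%R | i < n].

Lemma measurable_coord_div n (v : 'I_n -> R) :
  measurable_fun setT (coord_div v).
Proof.
apply/measurable_fun_tnthP => i.
rewrite (_ : _ \o _ = (fun x : euclid R n => tnth x i / v i)%R); last first.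
  by apply/funext => x /=; rewrite tnth_mktuple.
by apply: measurable_funM => //; exact: measurable_tnth.
Qed.

(** By induction on the dimension: a slice of the preimage at z is the preimage
of the slice at z divided by the first scale, so the induction hypothesis scales
the slices and a one-dimensional change of variables scales the outer integral. *)
Lemma lebesgue_euclid_coord_div n (v : 'I_n -> R) (A : set (euclid R n)) :
  (forall i, (0 < v i)%R) -> measurable A ->
  lebesgue_euclid R n (coord_div v @^-1` A) =
  (\prod_i v i)%:E * lebesgue_euclid R n A.
Proof.
elim: n v A => [|n IHn] v A v0 mA.
  rewrite big_ord0 mul1e; congr (lebesgue_euclid R 0 _).
  by apply/seteqP; split => x /=; rewrite (tuple0 (coord_div v x)) (tuple0 x).
pose v' i := v (lift ord0 i).
have v'0 i : (0 < v' i)%R by exact: v0.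
pose B := cons_pair @^-1` A.
have mB : measurable B.
  by rewrite -[X in measurable X]setTI; exact: measurable_cons_pair.
pose g (z : measurableTypeR R) : measurableTypeR R := (z / v ord0)%R.
have mg : measurable_fun setT g by exact: measurable_funM.
have consE z t : coord_div v (cons_pair (z, t)) = cons_pair (g z, coord_div v' t).
  apply: eq_from_tnth => i; rewrite tnth_mktuple.
  have [j ->|->] := unliftP ord0 i; rewrite ?tnthS ?tnth0 ?tnth_mktuple//.
rewrite /= /lebesgue_cons /product_measure1 /=.
rewrite (eq_integral (fun z => (\prod_i v' i)%:E *
    (lebesgue_euclid R n \o xsection B) (g z))); last first.
  move=> z _ /=; rewrite -IHn//; last exact: measurable_xsection.
  congr (lebesgue_euclid R n _); apply/seteqP.
  by split => t /=; rewrite /xsection /= !inE /B /= consE.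
have mS : measurable_fun setT (lebesgue_euclid R n \o xsection B).
  exact: measurable_fun_xsection.
rewrite ge0_integralZl//; last 2 first.
- exact: measurableT_comp mS mg.
- by rewrite lee_fin prodr_ge0// => i _; exact: ltW.
rewrite -[X in _ * X](ge0_integral_pushforward mg _ measurableT mS)//.
rewrite (@eq_measure_integral _ _ _ _ (mscale (NngNum (ltW (v0 ord0))) lebesgue_measure)).
  by rewrite ge0_integral_mscale//= big_ord_recl muleA -EFinM mulrC.
by move=> C mC _; exact: lebesgue_measure_div.
Qed.

End lebesgue_scaling.

(** * Dilations and the weighted measure *)

Section weighted_scaling.
Context {R : realType} {k : nat} (d : 'I_k -> nat) (theta : 'I_k -> R).
Variable W : forall r, @homogeneous_weight R (d r) (theta r).
Local Notation ambient := (euclid R (\sum_j d j)).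
Local Notation cone := (@positive_cone R k d).

Definition dilation_factor (s : 'I_k -> R) : R :=
  \prod_r (s r) `^ ((d r)%:R + theta r).

(** Each of the d(r) coordinates of the block r is scaled by s(r). *)
Lemma prod_tagnat_sig1 (s : 'I_k -> R) :
  \prod_(i < \sum_j d j) s (tagnat.sig1 i) = \prod_r s r ^+ d r.
Proof.
rewrite (eq_bigr (fun r => \prod_(i < d r) s r)); last first.
  by move=> r _; rewrite prodr_const card_ord.
by rewrite sig_big_dep/= (reindex _ tagnat.sig_bij_on).
Qed.

Lemma measurable_block_div (s : 'I_k -> R) :
  measurable_fun setT (block_div s : ambient -> ambient).
Proof. exact: measurable_coord_div. Qed.

Lemma positive_cone_block_div (s : 'I_k -> R) (x : ambient) :
  (forall r, 0 < s r) ->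
  positive_cone (block_div s x) <-> positive_cone x.
Proof.
move=> s0; rewrite /positive_cone /=.
have blockE r i : block r (block_div s x) 0 i = (s r)^-1 * block r x 0 i.
  by rewrite block_divE mxE.
by split => h r i; have := h r i; rewrite blockE pmulr_rge0// invr_gt0.
Qed.

Lemma density_block_div (s : 'I_k -> R) (x : ambient) :
  (forall r, 0 < s r) -> positive_cone x ->
  density W x = (\prod_r (s r) `^ theta r) * density W (block_div s x).
Proof.
move=> s0 Xx; rewrite /density -big_split; apply: eq_bigr => r _ /=.
rewrite block_divE weight_homogeneous ?invr_gt0//.
by rewrite mulrA -powRM ?invr_ge0 ?ltW// divff ?gt_eqF// powR1 mul1r.
Qed.

Lemma dilation_factorE (s : 'I_k -> R) : (forall r, 0 < s r) ->
  dilation_factor s = (\prod_r (s r) `^ theta r) * \prod_r s r ^+ d r.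
Proof.
move=> s0; rewrite -big_split; apply: eq_bigr => r _ /=.
rewrite powRD; last by rewrite (gt_eqF (s0 r)) implybT.
by rewrite powR_mulrn 1?mulrC//; exact: ltW.
Qed.

Lemma dilation_factor_gt0 (s : 'I_k -> R) : (forall r, 0 < s r) ->
  0 < dilation_factor s.
Proof. by move=> s0; apply: prodr_gt0 => r _; exact: powR_gt0. Qed.

Local Open Scope ereal_scope.

(** The Jacobian of the dilation contributes the powers d(r) of the s(r), the
homogeneity of the weights the powers theta(r). *)
Lemma weighted_measure_block_div (s : 'I_k -> R) (V : set ambient) :
  (forall r, (0 < s r)%R) -> measurable V ->
  weighted_measure W (block_div s @^-1` V) =
  (dilation_factor s)%:E * weighted_measure W V.
Proof.
move=> s0 mV; rewrite /weighted_measure.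
have mT := measurable_block_div s.
have mX : measurable cone := @measurable_positive_cone R k d.
have mVX : measurable (V `&` cone) by exact: measurableI.
have mdens : measurable_fun (V `&` cone) (EFin \o density W).
  by apply/measurable_EFinP; apply: measurable_funS (measurable_density W).
have dens0 x : (V `&` cone) x -> 0 <= (density W x)%:E.
  by move=> [_ Xx]; rewrite lee_fin density_ge0.
have -> : block_div s @^-1` V `&` cone =
    block_div s @^-1` (V `&` cone).
  apply/seteqP; split => x /= [Vx Xx]; split => //;
    exact/(positive_cone_block_div x s0).
set c : R := (\prod_r (s r) `^ theta r)%R.
have c0 : (0 <= c)%R by apply: prodr_ge0 => r _; exact: powR_ge0.
(* The integrand becomes a function of block_div s x, so that the integral is
   one against the image of Lebesgue measure under block_div s. *)
rewrite (eq_integral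
    (fun x => ((fun y => c%:E * (density W y)%:E) \o block_div s) x)); last first.
  move=> x; rewrite inE => -[_ /(positive_cone_block_div x s0) Xx] /=.
  by rewrite -EFinM -density_block_div.
rewrite -(ge0_integral_pushforward mT)//; last 2 first.
- exact: measurable_funeM.
- by move=> y; rewrite inE => /dens0 ?; rewrite mule_ge0.
pose v (i : 'I_(\sum_j d j)) := s (tagnat.sig1 i).
have v0 : (0 <= \prod_i v i)%R by apply: prodr_ge0 => i _; exact: ltW (s0 _).
rewrite (@eq_measure_integral _ _ _ _
    (mscale (NngNum v0) (lebesgue_euclid R _))).
  rewrite ge0_integral_mscale//=; last 2 first.
  - exact: measurable_funeM.
  - by move=> y /dens0 ?; rewrite mule_ge0.
  rewrite ge0_integralZl// muleA -EFinM; congr (_%:E * _).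
  by rewrite dilation_factorE// mulrC prod_tagnat_sig1.
by move=> C mC _; apply: lebesgue_euclid_coord_div => // i; exact: s0.
Qed.

Lemma Lnorm_dilation (s : 'I_k -> R) (f : ambient -> R) (p : R) :
  (forall r, (0 < s r)%R) -> measurable_fun setT f ->
  Lnorm (weighted_measure W) p%:E (EFin \o dilation s f) =
  ((dilation_factor s) `^ p^-1)%:E *
  Lnorm (weighted_measure W) p%:E (EFin \o f).
Proof.
move=> s0 mf; rewrite unlock -poweR_EFin.
have D0 := ltW (dilation_factor_gt0 s0).
rewrite -poweRM//; last by apply: integral_ge0 => x _; exact: poweR_ge0.
congr (_ `^ _).
have mg : measurable_fun setT (fun x : ambient => `|(EFin \o f) x| `^ p).
  apply: (measurableT_comp (measurable_poweR _)).
  by apply: measurableT_comp => //; exact/measurable_EFinP.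
have g0 (x : ambient) : 0 <= `|(EFin \o f) x| `^ p by exact: poweR_ge0.
rewrite -[LHS](ge0_integral_pushforward
  (measurable_block_div s) _ measurableT mg)//.
rewrite [LHS](eq_measure_integral
    (mscale (NngNum D0) (weighted_measure W))).
  by rewrite ge0_integral_mscale.
  exact: measurable_block_div.
by move=> mT V mV _; exact: weighted_measure_block_div.
Qed.

End weighted_scaling.

(** * The norm of the dilation between two grand Lebesgue spaces *)

Section dilation_norm_of_grand_lebesgue.
Context {R : realType} {k : nat} (d : 'I_k -> nat) (theta : 'I_k -> R).
Variable W : forall r, @homogeneous_weight R (d r) (theta r).
Variables (a : R) (b : \bar R) (psi zeta nu : R -> R).
Hypothesis Psi_psi : Psi (weighted_measure W) a b psi.
Hypothesis nu_ge1 : forall p, exponent_range a b p -> 1 <= nu p.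
Hypothesis zetaE : forall p, exponent_range a b p -> zeta p = psi p * nu p.
Local Notation Gpsi := (gls_norm (weighted_measure W) a b psi).
Local Notation Gzeta := (gls_norm (weighted_measure W) a b zeta).

(** Every f of the unit ball has |f|_p <= psi(p), which bounds the norm; the
function representing psi lies in the unit ball and turns all these inequalities
into equalities, so the bound is attained. *)
Lemma dilation_normE (s : 'I_k -> R) : (forall r, 0 < s r) ->
  dilation_norm Gpsi Gzeta s =
  ereal_sup [set (dilation_factor d theta s `^ p^-1 / nu p)%:E |
             p in exponent_range a b].
Proof.
move=> s0; have [[_ psi1 _ _] [f0 mf0 f0psi]] := Psi_psi.
have psi0 p : exponent_range a b p -> 0 < psi p.
  by move=> /psi1; exact: lt_le_trans.
have nu0 p : exponent_range a b p -> 0 < nu p.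
  by move=> /nu_ge1; exact: lt_le_trans.
have zeta0 p : exponent_range a b p -> 0 < zeta p.
  by move=> Pp; rewrite zetaE// mulr_gt0 ?psi0 ?nu0.
apply/eqP; rewrite eq_le; apply/andP; split; apply: ge_ereal_sup.
- move=> _ [f [mf f1] <-]; apply: ge_ereal_sup => _ [p Pp <-].
  apply: le_trans (ereal_sup_ubound _); last by exists p.
  have fpsi : (Lnorm (weighted_measure W) p%:E (EFin \o f) <= (psi p)%:E)%E.
    rewrite -[leRHS]mul1e -lee_pdivrMr ?psi0//; apply: le_trans f1.
    by apply: ereal_sup_ubound; exists p => //; rewrite inver gt_eqF ?psi0.
  rewrite inver gt_eqF ?zeta0// lee_pdivrMr ?zeta0// Lnorm_dilation//.
  apply: (le_trans (lee_wpmul2l _ fpsi)); first by rewrite lee_fin powR_ge0.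
  rewrite -!EFinM lee_fin zetaE// mulrA (mulrAC _ (psi p)).
  by rewrite mulfVK ?gt_eqF ?nu0.
- move=> _ [p Pp <-].
  apply: (@le_trans _ _ (Gzeta (dilation s f0))).
    apply: le_trans (ereal_sup_ubound _); last by exists p.
    rewrite Lnorm_dilation// f0psi// inver gt_eqF ?zeta0//.
    by rewrite -!EFinM lee_fin zetaE// invfM mulrA mulfK ?gt_eqF ?psi0.
  apply: ereal_sup_ubound; exists f0 => //; split => //.
  apply: ge_ereal_sup => _ [q Pq <-].
  by rewrite f0psi// inver gt_eqF ?psi0// -EFinM divff ?gt_eqF ?psi0.
Qed.

End dilation_norm_of_grand_lebesgue.

(** * The range of exponents *)

Section exponents.
Context {R : realType}.
Variables (a : R) (b : \bar R).
Hypotheses (a1 : 1 <= a) (ab : (a%:E < b)%E).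

Let a_gt0 : 0 < a. Proof. exact: lt_le_trans ltr01 a1. Qed.

(** The number 1/b, with the value 0 at b = oo. *)
Definition inv_right_end : R := fine (b^-1)%E.

Lemma exponent_range_inv p : exponent_range a b p ->
  [/\ 0 < p^-1, p^-1 <= 1, p^-1 <= a^-1 & inv_right_end <= p^-1].
Proof.
move=> [ap pb]; have p0 : 0 < p := lt_trans a_gt0 ap.
have p1 : 1 <= p := le_trans a1 (ltW ap).
split; rewrite ?invr_gt0 ?invf_le1 ?lef_pV2 ?posrE ?(ltW ap)//.
rewrite /inv_right_end; case: b ab pb => [r| |]//= ar; last first.
  by rewrite invr_ge0 ltW.
rewrite !lte_fin in ar * => pr; have r0 := lt_trans a_gt0 ar.
by rewrite inver gt_eqF//= lef_pV2 ?posrE// ltW.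
Qed.

Lemma left_of_b_filter : ProperFilter (left_of_b b).
Proof. by rewrite /left_of_b; case: b => *; exact: _. Qed.

Lemma near_left_end : \forall p \near a^'+, exponent_range a b p.
Proof.
rewrite /exponent_range; case: b ab => [r| |]//= ar; near=> p.
- split; near: p; first exact: nbhs_right_gt.
  by under eq_near do rewrite lte_fin; apply: nbhs_right_lt; rewrite -lte_fin.
- by split; [near: p; exact: nbhs_right_gt|rewrite ltry].
Unshelve. all: by end_near. Qed.

Lemma near_right_end : \forall p \near left_of_b b, exponent_range a b p.
Proof.
rewrite /exponent_range /left_of_b; case: b ab => [r| |]//= ar; near=> p.
- split; near: p; first by apply: nbhs_left_gt; rewrite -lte_fin.
  by under eq_near do rewrite lte_fin; exact: nbhs_left_lt.
- by split; [near: p; apply: nbhs_pinfty_gt; exact: num_real|rewrite ltry].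
Unshelve. all: by end_near. Qed.

Lemma inv_cvg_left_end : p^-1 @[p --> a^'+] --> a^-1.
Proof.
by apply: cvg_at_right_filter; apply: cvgV; rewrite ?gt_eqF//; exact: cvg_id.
Qed.

Lemma inv_cvg_right_end : p^-1 @[p --> left_of_b b] --> inv_right_end.
Proof.
rewrite /inv_right_end /left_of_b; case: b ab => [r| |]//= ar.
  have r0 : 0 < r by rewrite (lt_trans a_gt0).
  rewrite inver gt_eqF//=; apply: cvg_at_left_filter.
  by apply: cvgV; rewrite ?gt_eqF//; exact: cvg_id.
apply/gtr0_cvgV0; last exact: cvg_id.
by apply: nbhs_pinfty_gt; exact: num_real.
Qed.

Lemma mule_inv_right_end (c : R) : (c%:E / b = (c * inv_right_end)%:E)%E.
Proof.
rewrite /inv_right_end; case: b ab => [r| |]//= ar.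
have r0 : 0 < r by rewrite (lt_trans a_gt0).
by rewrite inver gt_eqF.
Qed.

Lemma exponent_range_neq0 : exists p, exponent_range a b p.
Proof. exact: (@filter_ex _ (a^'+) _ _ near_left_end). Qed.

(** The logarithm L of the supremum is characterised by the two bounds that the
asymptotics need: it dominates each term of the family, and every uniform bound
of the ln D / p bounds it, because nu >= 1. *)
Lemma ln_ereal_sup_quotients (nu : R -> R) (D : R) :
  0 < D -> (forall p, exponent_range a b p -> 1 <= nu p) ->
  exists L : R,
  [/\ ereal_sup [set (D `^ p^-1 / nu p)%:E | p in exponent_range a b] =
        (expR L)%:E,
      forall p, exponent_range a b p -> ln D / p - ln (nu p) <= L &
      forall M, (forall p, exponent_range a b p -> ln D / p <= M) -> L <= M].
Proof.
move=> D0 nu1; set S := ereal_sup _.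
have nu0 p : exponent_range a b p -> 0 < nu p.
  by move=> /nu1; exact: lt_le_trans.
have upper M : (forall p, exponent_range a b p -> ln D / p <= M) ->
    (S <= (expR M)%:E)%E.
  move=> DM; apply: ge_ereal_sup => _ [p Pp <-]; rewrite lee_fin.
  rewrite ler_pdivrMr ?nu0//; apply: (@le_trans _ _ (expR M)).
    rewrite -[D `^ _]lnK ?posrE ?powR_gt0// ler_expR ln_powR mulrC.
    exact: DM.
  by rewrite ler_peMr ?expR_ge0 ?nu1.
have lower p : exponent_range a b p -> ((D `^ p^-1 / nu p)%:E <= S)%E.
  by move=> Pp; apply: ereal_sup_ubound; exists p.
have [p0 Pp0] := exponent_range_neq0.
have S_gt0 : (0 < S)%E.
  by apply: lt_le_trans (lower _ Pp0); rewrite lte_fin divr_gt0 ?powR_gt0 ?nu0.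
have S_fin : S \is a fin_num.
  rewrite ge0_fin_numE ?ltW//.
  (* 1/p <= 1 since a >= 1, so |ln D| bounds the exponents uniformly. *)
  apply: (le_lt_trans (upper `|ln D| _)); last exact: ltry.
  move=> p /exponent_range_inv[p'0 p'1 _ _].
  apply: (le_trans (ler_norm _)); rewrite normrM (gtr0_norm p'0).
  by rewrite ler_piMr.
have SE : S = (expR (ln (fine S)))%:E.
  by rewrite lnK ?fineK// posrE fine_gt0// S_gt0 ltey_eq S_fin.
exists (ln (fine S)); split => //.
- move=> p Pp; rewrite -ler_expR -lee_fin -SE; apply: le_trans (lower _ Pp).
  rewrite lee_fin expRD expRN lnK ?posrE ?nu0//.
  by rewrite [ln D / p]mulrC -ln_powR lnK ?posrE ?powR_gt0.
- by move=> M /upper; rewrite {1}SE lee_fin ler_expR.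
Qed.

End exponents.

(** * Logarithmic asymptotics *)

Section boyd_asymptotics.
Context {R : realType}.

(** A squeeze with one upper bound and a family of lower bounds. Each lower bound
may become valid only late in F, and its limit slope(p) may stay away from l; it is
enough that the slopes approach l along the auxiliary filter G on the indices.
Below e is 1 / log t, and G describes the approach of p to an end of (a, b). *)
Lemma cvg_from_affine_bounds {T I : Type} {F : set_system T} {FF : Filter F}
    {G : set_system I} {FG : ProperFilter G} (P : set I)
    (e g : T -> R) (slope shift : I -> R) (l C : R) :
  e @ F --> 0 ->
  (\forall t \near F, g t <= l + C * e t) ->
  (\forall p \near G, P p) -> slope @ G --> l ->
  (forall p, P p -> \forall t \near F, slope p + shift p * e t <= g t) ->
  g @ F --> l.
Proof.
move=> e0 upper GP slopel lower; apply/cvgrPdist_le => eps eps0.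
have eps20 : 0 < eps / 2 by rewrite divr_gt0.
have Gl : \forall p \near G, `|l - slope p| <= eps / 2.
  by move/cvgrPdist_le : slopel; exact.
have [p [Pp pl]] := filter_ex (filterI GP Gl).
have small c : \forall t \near F, `|c * e t| <= eps / 2.
  have : c * e t @[t --> F] --> 0 by rewrite -(mulr0 c); apply: cvgMl_tmp.
  by move/cvgr0Pnorm_le; exact.
near=> t; rewrite ler_distlC.
have h1 : g t <= l + C * e t by near: t.
have h2 : slope p + shift p * e t <= g t by near: t; exact: lower.
have h3 : `|C * e t| <= eps / 2 by near: t; exact: small.
have h4 : `|shift p * e t| <= eps / 2 by near: t; exact: small.
move: pl h3 h4; rewrite !ler_norml => /andP[? ?] /andP[? ?] /andP[? ?].
by apply/andP; split; lra.
Unshelve. all: by end_near. Qed.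

Lemma inv_ln_cvg_pinfty : (ln t)^-1 @[t --> +oo] --> (0 : R).
Proof.
apply/gtr0_cvgV0.
  near=> t; apply: ln_gt0; near: t; apply: nbhs_pinfty_gt; exact: num_real.
apply/cvgryPge => A; near=> t.
have At : expR A <= t by near: t; apply: nbhs_pinfty_ge; exact: num_real.
by rewrite -[A]expRK ler_ln ?posrE ?expR_gt0// (lt_le_trans _ At) ?expR_gt0.
Unshelve. all: by end_near. Qed.

Lemma near0_ln_lt0 : \forall t \near (0 : R)^'+, 0 < t /\ ln t < 0.
Proof.
near=> t; have t0 : 0 < t by near: t; exact: nbhs_right_gt.
by split=> //; apply: ln_lt0; rewrite t0 /=; near: t; exact: nbhs_right_lt.
Unshelve. all: by end_near. Qed.

Lemma inv_ln_cvg_0 : (ln t)^-1 @[t --> 0^'+] --> (0 : R).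
Proof.
apply/ltr0_cvgV0; last exact: lnNy.
by apply: filterS near0_ln_lt0 => t [].
Qed.

Lemma near_pinfty_ln_gt0 : \forall t \near +oo, 0 < t /\ 0 < ln (t : R).
Proof.
near=> t; have t1 : 1 < t by near: t; apply: nbhs_pinfty_gt; exact: num_real.
by split; [exact: lt_trans t1|exact: ln_gt0].
Unshelve. all: by end_near. Qed.

(* L t is the logarithm of the norm of the dilation when its varying scale is t,
   c * ln t + kappa being the logarithm of the dilation factor. *)
Variables (a : R) (b : \bar R) (nu : R -> R) (c kappa : R) (L : R -> R).
Hypotheses (a1 : 1 <= a) (ab : (a%:E < b)%E) (c0 : 0 <= c).
Hypothesis L_ge : forall t p, 0 < t -> exponent_range a b p ->
  (kappa + c * ln t) / p - ln (nu p) <= L t.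
Hypothesis L_le : forall t M, 0 < t ->
  (forall p, exponent_range a b p -> (kappa + c * ln t) / p <= M) -> L t <= M.

(** For ln t > 0 the slopes c / p approach their supremum as p tends to a;
|kappa| bounds kappa / p uniformly, as p >= 1. *)
Lemma log_sup_cvg_pinfty : L t / ln t @[t --> +oo] --> c / a.
Proof.
apply: (@cvg_from_affine_bounds _ _ _ _ (a^'+) _ (exponent_range a b) _ _
  (fun p => c / p) (fun p => kappa / p - ln (nu p)) _ `|kappa| inv_ln_cvg_pinfty).
- apply: filterS near_pinfty_ln_gt0 => t [t0 lt0].
  rewrite ler_pdivrMr// mulrDl mulfVK ?gt_eqF//.
  apply: L_le => // p /(exponent_range_inv a1 ab)[p'0 p'1 p'a _].
  rewrite mulrDl addrC lerD//.
    by rewrite mulrAC ler_wpM2r ?(ltW lt0)// ler_wpM2l.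
  by rewrite (le_trans (ler_norm _))// normrM (gtr0_norm p'0) ler_piMr.
- exact: near_left_end.
- by apply: cvgMl_tmp; exact: inv_cvg_left_end.
- move=> p Pp; apply: filterS near_pinfty_ln_gt0 => t [t0 lt0].
  rewrite ler_pdivlMr// mulrDl mulfVK ?gt_eqF//.
  by apply: le_trans (L_ge t0 Pp); rewrite mulrDl mulrAC; lra.
Qed.

(** Since ln t < 0, dividing by it reverses all bounds; the squeeze applies to
the opposite function, whose slopes - c / p approach their supremum as p tends to
b. *)
Lemma log_sup_cvg_0 : L t / ln t @[t --> 0^'+] --> c * inv_right_end b.
Proof.
have FG := left_of_b_filter b.
rewrite -[X in _ --> X]opprK -[X in X @ _]opprK; apply: cvgN.
apply: (@cvg_from_affine_bounds _ _ _ _ (left_of_b b) (left_of_b_filter b)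
  (exponent_range a b) _ _
  (fun p => - (c / p)) (fun p => ln (nu p) - kappa / p) _ (- `|kappa|)
  inv_ln_cvg_0).
- apply: filterS near0_ln_lt0 => t [t0 lt0].
  rewrite mulNr -opprD lerN2 ler_ndivlMr// mulrDl mulfVK ?lt_eqF//.
  apply: L_le => // p /(exponent_range_inv a1 ab)[p'0 p'1 _ p'b].
  rewrite mulrDl addrC lerD//.
    by rewrite mulrAC ler_wnM2r ?(ltW lt0)// ler_wpM2l.
  by rewrite (le_trans (ler_norm _))// normrM (gtr0_norm p'0) ler_piMr.
- exact: near_right_end.
- by apply: cvgN; apply: cvgMl_tmp; exact: (inv_cvg_right_end a1 ab).
- move=> p Pp; apply: filterS near0_ln_lt0 => t [t0 lt0].
  rewrite lerNr opprD opprK -mulNr opprB ler_ndivrMr// mulrDl mulfVK ?lt_eqF//.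
  by apply: le_trans (L_ge t0 Pp); rewrite mulrDl mulrAC; lra.
Qed.

End boyd_asymptotics.

(** * The Boyd indices *)

Lemma ln_dilation_factor_eta {R : realType} {k : nat} (d : 'I_k -> nat)
    (theta s : 'I_k -> R) (j : 'I_k) (t : R) :
  (forall i, 0 < s i) -> 0 < t ->
  ln (dilation_factor d theta [eta s with j |-> t]) =
  ln (\prod_(r | r != j) (s r) `^ ((d r)%:R + theta r)) +
  ((d j)%:R + theta j) * ln t.
Proof.
move=> s0 t0; rewrite /dilation_factor (bigD1 j)//= eqxx.
rewrite [X in ln (_ * X)](eq_bigr (fun r => (s r) `^ ((d r)%:R + theta r))).
  rewrite lnM ?posrE ?powR_gt0 ?prodr_gt0 ?ln_powR 1?addrC//.
  by move=> r _; exact: powR_gt0.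
by move=> r /negbTE ->.
Qed.

Theorem theorem1p2 (R : realType) (k : nat) (d : 'I_k -> nat) (theta : 'I_k -> R)
    (W : forall r, @homogeneous_weight R (d r) (theta r))
    (a : R) (b : \bar R) (psi zeta nu : R -> R) :
  (0 < k)%N ->
  (forall j, (0 < d j)%N) ->
  1 <= a -> (a%:E < b)%E ->
  Psi (weighted_measure W) a b psi ->
  EPsi a b zeta -> EPsi a b nu ->
  (forall p, exponent_range a b p -> zeta p = psi p * nu p) ->
  let Gpsi := gls_norm (weighted_measure W) a b psi in
  let Gzeta := gls_norm (weighted_measure W) a b zeta in
  (forall s : 'I_k -> R, (forall i, 0 < s i) ->
     (dilation_norm Gpsi Gzeta s < +oo)%E) /\
  (forall (j : 'I_k) (s : 'I_k -> R), (forall i, 0 < s i) ->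
     0 <= (d j)%:R + theta j ->
     [/\ cvg (boyd_quotient Gpsi Gzeta j s t @[t --> +oo]),
         boyd_upper Gpsi Gzeta j s = (((d j)%:R + theta j)%:E / a%:E)%E,
         cvg (boyd_quotient Gpsi Gzeta j s t @[t --> 0^'+]) &
         boyd_lower Gpsi Gzeta j s = (((d j)%:R + theta j)%:E / b)%E]).
Proof.
move=> _ _ a1 ab Psi_psi _ [_ nu1 _ _] zetaE Gpsi Gzeta.
pose D s := dilation_factor d theta s.
have logsup (s : 'I_k -> R) : (forall i, 0 < s i) -> exists L : R,
    [/\ dilation_norm Gpsi Gzeta s = (expR L)%:E,
      forall p, exponent_range a b p -> ln (D s) / p - ln (nu p) <= L &
      forall M, (forall p, exponent_range a b p -> ln (D s) / p <= M) -> L <= M].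
  move=> s0; rewrite (dilation_normE Psi_psi nu1 zetaE s0).
  by apply: ln_ereal_sup_quotients => //; exact: dilation_factor_gt0.
split=> [s /logsup[L [-> _ _]]|j s s0 c0]; first exact: ltry.
have st0 t : 0 < t -> forall i, 0 < [eta s with j |-> t] i.
  by move=> t0 i /=; case: ifP.
set c := (d j)%:R + theta j in c0 *.
pose kappa := ln (\prod_(r | r != j) (s r) `^ ((d r)%:R + theta r)).
have /choice[L LP] : forall t, exists L : R, 0 < t ->
    [/\ dilation_norm Gpsi Gzeta [eta s with j |-> t] = (expR L)%:E,
      forall p, exponent_range a b p -> (kappa + c * ln t) / p - ln (nu p) <= L &
      forall M, (forall p, exponent_range a b p -> (kappa + c * ln t) / p <= M) ->
        L <= M].
  move=> t; have [t0|_] := ltP 0 t; last by exists 0.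
  have [L] := logsup _ (st0 t t0); rewrite /D ln_dilation_factor_eta// => HL.
  by exists L.
have L_ge t p : 0 < t -> exponent_range a b p ->
    (kappa + c * ln t) / p - ln (nu p) <= L t.
  by move=> /LP[_ + _]; exact.
have L_le t M : 0 < t ->
    (forall p, exponent_range a b p -> (kappa + c * ln t) / p <= M) -> L t <= M.
  by move=> /LP[_ _]; exact.
have quotE t : 0 < t -> ln t != 0 ->
    boyd_quotient Gpsi Gzeta j s t = (L t / ln t)%:E.
  move=> t0 lt0; have [DL _ _] := LP _ t0.
  by rewrite /boyd_quotient DL lne_EFin ?expR_gt0// expRK inver (negbTE lt0).
have cvg_quot (F : set_system R) (l : R) : Filter F ->
    (\forall t \near F, 0 < t /\ ln t != 0) -> L t / ln t @[t --> F] --> l ->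
    boyd_quotient Gpsi Gzeta j s t @[t --> F] --> l%:E.
  move=> FF Fln Ll; apply: cvg_EFin.
    by apply: filterS Fln => t [t0 lt0]; rewrite quotE.
  apply: cvg_trans Ll; apply: near_eq_cvg.
  by apply: filterS Fln => t [t0 lt0] /=; rewrite quotE.
have upper : boyd_quotient Gpsi Gzeta j s t @[t --> +oo] --> (c%:E / a%:E)%E.
  rewrite inver gt_eqF ?(lt_le_trans ltr01 a1)//; apply: cvg_quot.
    by apply: filterS near_pinfty_ln_gt0 => t [t0 lt0]; rewrite gt_eqF.
  exact: log_sup_cvg_pinfty a1 ab c0 L_ge L_le.
have lower : boyd_quotient Gpsi Gzeta j s t @[t --> 0^'+] --> (c%:E / b)%E.
  rewrite (mule_inv_right_end a1 ab); apply: cvg_quot.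
    by apply: filterS near0_ln_lt0 => t [t0 lt0]; rewrite lt_eqF.
  exact: log_sup_cvg_0 a1 ab c0 L_ge L_le.
split.
- by apply/cvg_ex; exists (c%:E / a%:E)%E.
- exact: cvg_lim upper.
- by apply/cvg_ex; exists (c%:E / b)%E.
- exact: cvg_lim lower.
Qed.
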